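(* Let $P$ be a projection algebra. Then: (i) $\mathsf{PG}(P)$ is a regular $*$-semigroup with projection algebra $P$; (ii) for any regular $*$-semigroup $S$, and any projection algebra morphism $\phi:P\to\mathbf P(S)$, there is a unique $*$-semigroup homomorphism $\overline\phi:\mathsf{PG}(P)\to S$ such that $p\overline\phi=p\phi$ for all $p\in P$ (i.e. $\overline\phi$ composed after the inclusion $P\hookrightarrow\mathsf{PG}(P)$ equals $\phi$ followed by the inclusion $\mathbf P(S)\hookrightarrow S$); and moreover any $*$-semigroup homomorphism $\mathsf{PG}(P)\to S$ has the form $\overline\phi$ for some projection algebra morphism $\phi:P\to\mathbf P(S)$.
   Context: Maps are written to the right of their arguments and composed left to right. A regular $*$-semigroup is a semigroup $S$ with a unary operation $a\mapsto a^*$ satisfying $(a^* )^*=a=aa^*a$ and $(ab)^*=b^*a^*$ for all $a,b\in S$. A $*$-semigroup homomorphism is a semigroup homomorphism $\phi$ with $(a^* )\phi=(a\phi)^*$. The set of projections is $\mathbf P(S)=\{p\in S: p^2=p=p^*\}$. A projection algebra is a set $P$ with unary operations $\theta_p:P\to P$ ($p\in P$) such that for all $p,q\in P$: $p\theta_p=p$; $\theta_p\theta_p=\theta_p$; $p\theta_q\theta_p=q\theta_p$; $\theta_p\theta_q\theta_p=\theta_{q\theta_p}$; $\theta_p\theta_q\theta_p\theta_q=\theta_p\theta_q$. Morphisms are maps $\phi:P\to P'$ satisfying $(p\theta_q)\phi=(p\phi)\theta_{q\phi}$ for all $p,q\in P$. For a regular $*$-semigroup $S$, $\mathbf P(S)$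 is a projection algebra with $q\theta_p=pqp$. On a projection algebra $P$ define: $p\leq_{\mathscr F}q$ iff $p=q\theta_p$; and $p\mathrel{\mathscr F}q$ iff $p\leq_{\mathscr F}q$ and $q\leq_{\mathscr F}p$. A $P$-path is a tuple $(p_1,\ldots,p_k)\in P^k$ ($k\geq1$) with $p_1\mathrel{\mathscr F}\cdots\mathrel{\mathscr F}p_k$, regarded as a morphism $p_1\to p_k$. The path category $\mathscr P(P)$ has object set $P$, morphisms all $P$-paths, composition $(p_1,\ldots,p_k)\circ(p_k,\ldots,p_l)=(p_1,\ldots,p_k,\ldots,p_l)$, and identities $(p)$, identified with $p$. For $p\in P$, a pair $(e,f)\in P\times P$ is $p$-linked if $f=e\theta_p\theta_f$ and $e=f\theta_p\theta_e$; then $\lambda(e,p,f)=(e,e\theta_p,f)$ and $\rho(e,p,f)=(e,f\theta_p,f)$ are $P$-paths. Let $\equiv$ be the (category) congruence on $\mathscr P(P)$ generated by all pairs $((p,p),(p))$ with $p\in P$, all pairs $((p,q,p),(p))$ with $p\mathrel{\mathscr F}q$, and all pairs $(\lambda(e,p,f),\rho(e,p,f))$ with $p\in P$ and $(e,f)$ a $p$-linked pair. The $\equiv$-class of $(p_1,\ldots,p_k)$ is denoted $[\![p_1,\ldots,p_k]\!]$ (a reduced chain). The chain semigroup $\mathsf{PG}(P)$ is the set of all reduced chains, with $[\![p_1,\ldots,p_k]\!]^*=[\![p_k,\ldots,p_1]\!]$ and $[\![p_1,\ldots,p_k]\!]\bullet[\![q_1,\ldots,q_l]\!]=[\![p_1',\ldots,p_k',q_1',\ldots,q_l']\!]$,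 where, with $p'=q_1\theta_{p_k}$ and $q'=p_k\theta_{q_1}$, $p_i'=p'\theta_{p_k}\cdots\theta_{p_i}$ and $q_j'=q'\theta_{q_1}\cdots\theta_{q_j}$. Each $p\in P$ is identified with $[\![p]\!]\in\mathsf{PG}(P)$. *)

(* Defs.v *)
From HB Require Import structures.
From mathcomp Require Import all_boot boolp.

Set Implicit Arguments.
Unset Strict Implicit.
Unset Printing Implicit Defensive.

Local Open Scope group_scope.
Local Open Scope quotient_scope.

(* Carriers are choiceTypes, as everywhere in MathComp.  This is no loss of
   generality: boolp equips every type T with such a structure ({classic T}). *)

HB.mixin Record hasStar S := { star : S -> S }.

#[short(type="starMagmaType")]
HB.structure Definition StarMagma := {S of hasStar S & ChoiceMagma S}.

HB.mixin Record StarMagma_isRegular S of StarMagma S := {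
  starK : involutive (@star S);
  mul_starK : forall a : S, a * star a * a = a;
  starM : forall a b : S, star (a * b) = star b * star a
}.

#[short(type="regularStarType")]
HB.structure Definition RegularStar :=
  {S of StarMagma S & Semigroup S & StarMagma_isRegular S}.

Definition is_regular_star (S : starMagmaType) : Prop :=
  [/\ associative (@mul S),
      involutive (@star S),
      forall a : S, a * star a * a = a &
      forall a b : S, star (a * b) = star b * star a].

Section RegularStarOf.
Variables (S : starMagmaType) (hS : is_regular_star S).

Let hA : associative (@mul S). Proof. by case: hS. Qed.
Let hK : involutive (@star S). Proof. by case: hS. Qed.
Let hR (a : S) : a * star a * a = a. Proof. by case: hS => _ _ /(_ a). Qed.
Let hM (a b : S) : star (a * b) = star b * star a.
Proof. by case: hS => _ _ _ /(_ a b). Qed.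

Definition regular_star_sort (_ : is_regular_star S) : Type := S.
Local Notation T := (regular_star_sort hS).

HB.instance Definition _ := StarMagma.copy T S.
HB.instance Definition _ := Magma_isSemigroup.Build T hA.
HB.instance Definition _ := StarMagma_isRegular.Build T hK hR hM.

Definition regular_star_of : regularStarType := T.

End RegularStarOf.

Definition star_morphism (S T : starMagmaType) (f : S -> T) : Prop :=
  {morph f : a b / a * b} /\ {morph f : a / star a}.

(* theta p : P -> P is the unary operation theta_p.  In the literature it is
   written on the right of its argument and composed left to right, as in
   x \th_ p \th_ q below, so the order of the subscripts is reversed here. *)
HB.mixin Record isProjAlg P of Choice P := {
  theta : P -> P -> P;
  theta_self : forall p, theta p p = p;
  theta_idem : forall p x, theta p (theta p x) = theta p x;
  theta_swap : forall p q, theta p (theta q p) = theta p q;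
  theta_conj : forall p q x,
    theta p (theta q (theta p x)) = theta (theta p q) x;
  theta_alt : forall p q x,
    theta q (theta p (theta q (theta p x))) = theta q (theta p x)
}.

#[short(type="projAlgType")]
HB.structure Definition ProjAlg := {P of isProjAlg P & Choice P}.

Notation "x \th_ p" := (theta p x)
  (at level 40, p at level 2, left associativity, format "x  \th_ p").

Definition proj_morphism (P Q : projAlgType) (f : P -> Q) : Prop :=
  forall p q : P, f (p \th_ q) = f p \th_ (f q).

Definition is_proj (S : starMagmaType) : pred S :=
  [pred p | (p * p == p) && (star p == p)].

Record proj (S : starMagmaType) := Proj { proj_val :> S; _ : is_proj proj_val }.

HB.instance Definition _ S := [isSub for @proj_val S].
HB.instance Definition _ S := [Choice of proj S by <:].

Section Projections.
Variable S : regularStarType.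
Implicit Types p q x : proj S.
Local Notation v := (@proj_val S).

Lemma proj_mulE p : v p * v p = v p.
Proof. by case: p => p /= /andP[/eqP]. Qed.

Lemma proj_starE p : star (v p) = v p.
Proof. by case: p => p /= /andP[_ /eqP]. Qed.

Lemma proj_star_mul q p : v q * v p * v q * v p = v q * v p.
Proof.
have := mul_starK (v q * v p); rewrite starM !proj_starE !mulgA.
by rewrite -(mulgA (v q)) proj_mulE -(mulgA (v q * v p)) proj_mulE.
Qed.

Lemma proj_conjP p q : is_proj (v p * v q * v p).
Proof.
apply/andP; split; apply/eqP.
  by rewrite !mulgA -(mulgA (v p * v q)) proj_mulE proj_star_mul.
by rewrite !starM !proj_starE mulgA.
Qed.

Definition proj_theta p q : proj S := Proj (proj_conjP p q).

Fact proj_theta_self p : proj_theta p p = p.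
Proof. by apply: val_inj; rewrite /= !proj_mulE. Qed.

Fact proj_theta_idem p x : proj_theta p (proj_theta p x) = proj_theta p x.
Proof.
by apply: val_inj; rewrite /= !mulgA proj_mulE -(mulgA (v p * v x)) proj_mulE.
Qed.

Fact proj_theta_swap p q : proj_theta p (proj_theta q p) = proj_theta p q.
Proof. by apply: val_inj; rewrite /= !mulgA proj_star_mul. Qed.

Fact proj_theta_conj p q x :
  proj_theta p (proj_theta q (proj_theta p x)) = proj_theta (proj_theta p q) x.
Proof. by apply: val_inj; rewrite /= !mulgA. Qed.

Fact proj_theta_alt p q x :
  proj_theta q (proj_theta p (proj_theta q (proj_theta p x))) =
  proj_theta q (proj_theta p x).
Proof.
apply: val_inj; rewrite /= !mulgA proj_star_mul.
rewrite -!mulgA; congr (_ * (_ * (_ * _))); rewrite !mulgA.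
by rewrite proj_star_mul.
Qed.

HB.instance Definition _ := isProjAlg.Build (proj S)
  proj_theta_self proj_theta_idem proj_theta_swap
  proj_theta_conj proj_theta_alt.

End Projections.

Section Paths.
Variable P : projAlgType.
Implicit Types (p q e f x y : P) (s t : seq P) (u v w : P * seq P).

Definition leF p q := p == q \th_ p.
Definition eqF p q := leF p q && leF q p.

(* The tuple (p_1, ..., p_k) is encoded as the pair (p_1, [:: p_2; ...; p_k]). *)
Record ppath := PPath { pts :> P * seq P; _ : path eqF pts.1 pts.2 }.

HB.instance Definition _ := [isSub for pts].
HB.instance Definition _ := [Choice of ppath by <:].

Implicit Types a b c d : ppath.

Lemma ppathP a : path eqF (pts a).1 (pts a).2. Proof. by case: a. Qed.

Definition src u := u.1.
Definition tgt u := last u.1 u.2.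

Definition id_path p : ppath := @PPath (p, [::]) isT.

Definition comp_pts u v : P * seq P := (u.1, u.2 ++ v.2).

Lemma comp_pathP a b :
  tgt a = src b -> path eqF (comp_pts a b).1 (comp_pts a b).2.
Proof. by rewrite /tgt /src cat_path ppathP /= => ->; exact: ppathP. Qed.

Definition ppath_comp a b (h : tgt a = src b) : ppath := PPath (comp_pathP h).

Definition linked p e f :=
  (f == e \th_ p \th_ f) && (e == f \th_ p \th_ e).

Definition lambda_pts e p f : P * seq P := (e, [:: e \th_ p; f]).
Definition rho_pts e p f : P * seq P := (e, [:: f \th_ p; f]).

Inductive chain_gen : P * seq P -> P * seq P -> Prop :=
| GenId p : chain_gen (p, [:: p]) (p, [::])
| GenBack p q : eqF p q -> chain_gen (p, [:: q; p]) (p, [::])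
| GenLinked p e f :
    linked p e f -> chain_gen (lambda_pts e p f) (rho_pts e p f).

(* The congruence generated by chain_gen (both sides of a generating pair are
   P-paths, see chain_gen_path below). *)
Inductive chain_eq : ppath -> ppath -> Prop :=
| ChainGen a b : chain_gen a b -> chain_eq a b
| ChainRefl a : chain_eq a a
| ChainSym a b : chain_eq a b -> chain_eq b a
| ChainTrans a b c : chain_eq a b -> chain_eq b c -> chain_eq a c
| ChainComp a a' b b' (h : tgt a = src b) (h' : tgt a' = src b') :
    chain_eq a a' -> chain_eq b b' -> chain_eq (ppath_comp h) (ppath_comp h').

Definition chain_rel : rel ppath := fun a b => `[< chain_eq a b >].

Fact chain_rel_refl : reflexive chain_rel.
Proof. by move=> a; apply/asboolP; exact: ChainRefl. Qed.

Fact chain_rel_sym : symmetric chain_rel.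
Proof. by move=> a b; apply/asboolP/asboolP; exact: ChainSym. Qed.

Fact chain_rel_trans : transitive chain_rel.
Proof.
by move=> b a c /asboolP ab /asboolP bc; apply/asboolP; exact: ChainTrans bc.
Qed.

Canonical chain_equiv :=
  EquivRel chain_rel chain_rel_refl chain_rel_sym chain_rel_trans.

Definition PG : Type := {eq_quot chain_equiv}.
HB.instance Definition _ := Choice.on PG.
HB.instance Definition _ := EqQuotient.on PG.

Definition chain a : PG := \pi_PG a.

Definition rev_pts u : P * seq P := (last u.1 u.2, rev (belast u.1 u.2)).

(* (x theta_(p_1), x theta_(p_1) theta_(p_2), ...) *)
Definition restr_pts x u : P * seq P :=
  (x \th_ u.1, scanl (fun y q => y \th_ q) (x \th_ u.1) u.2).

Definition cat_pts u v : P * seq P := (u.1, u.2 ++ v.1 :: v.2).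

(* (p'_1, ..., p'_k, q'_1, ..., q'_l); the p'_i are computed from the last one
   backwards, hence the two reversals. *)
Definition prod_pts u v : P * seq P :=
  let p' := src v \th_ (tgt u) in
  let q' := tgt u \th_ (src v) in
  cat_pts (rev_pts (restr_pts p' (rev_pts u))) (restr_pts q' v).

Lemma eqF_sym p q : eqF p q = eqF q p. Proof. exact: andbC. Qed.

Lemma restr_step x p q :
  eqF p q -> eqF (x \th_ p) (x \th_ p \th_ q).
Proof.
move=> /andP[/eqP pq _]; apply/andP; split; apply/eqP.
  by rewrite theta_swap -theta_conj -pq theta_swap.
by move: (x \th_ p) => y; rewrite -theta_conj !theta_swap.
Qed.

Lemma linked_eqF p e f : linked p e f -> eqF e (e \th_ p) && eqF (e \th_ p) f.
Proof.
move=> /andP[/eqP fE /eqP eE].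
have eK : e \th_ p \th_ e = e by have := theta_alt p e f; rewrite -eE.
by rewrite /eqF /leF -!theta_conj eK -eE -fE !eqxx.
Qed.

Lemma linked_sym p e f : linked p e f = linked p f e.
Proof. exact: andbC. Qed.

Lemma chain_gen_path u v :
  chain_gen u v -> path eqF u.1 u.2 && path eqF v.1 v.2.
Proof.
have eqF_refl p : eqF p p by rewrite /eqF /leF theta_self eqxx.
case=> [p|p q pq|p e f pef] /=; rewrite ?andbT.
- exact: eqF_refl.
- by rewrite pq eqF_sym pq.
rewrite linked_eqF //=; rewrite linked_sym in pef.
by have /andP[h1 h2] := linked_eqF pef; rewrite eqF_sym h2 eqF_sym h1.
Qed.

Lemma rev_pathP a : path eqF (rev_pts a).1 (rev_pts a).2.
Proof.
by rewrite /= rev_path (eq_path (e' := eqF)) ?ppathP // => p q; rewrite eqF_sym.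
Qed.

Lemma restr_pathP x a : path eqF (restr_pts x a).1 (restr_pts x a).2.
Proof.
case: a => [[p s] /=]; elim: s p x => //= q s IHs p x /andP[pq /IHs qs].
by rewrite restr_step //= qs.
Qed.

Lemma cat_pathP a b :
  eqF (tgt a) (src b) -> path eqF (cat_pts a b).1 (cat_pts a b).2.
Proof. by move=> h; rewrite cat_path ppathP /= ppathP andbT. Qed.

Definition rev_ppath a : ppath := PPath (rev_pathP a).
Definition ppath_restr x a : ppath := PPath (restr_pathP x a).

Lemma tgt_rev u : tgt (rev_pts u) = src u.
Proof. by case: u => p [|q s]; rewrite /tgt //= rev_cons last_rcons. Qed.

Lemma prod_connect p q : eqF (q \th_ p \th_ p) (p \th_ q \th_ q).
Proof. by rewrite !theta_idem /eqF /leF -!theta_conj !theta_swap !eqxx. Qed.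

Lemma prod_pathP a b : path eqF (prod_pts a b).1 (prod_pts a b).2.
Proof.
apply: (@cat_pathP (rev_ppath (ppath_restr (src b \th_ (tgt a)) (rev_ppath a)))
                   (ppath_restr (tgt a \th_ (src b)) b)).
by rewrite tgt_rev; exact: prod_connect.
Qed.

Definition ppath_prod a b : ppath := PPath (prod_pathP a b).

Lemma chain_eq_ends a b : chain_eq a b -> src a = src b /\ tgt a = tgt b.
Proof.
elim=> {a b} [a b|||a b c _ [-> ->] _ [-> ->]|] //.
- by rewrite /tgt /src; case.
- by move=> a b _ [-> ->].
move=> a a' b b' h h' _ [sa _] _ [_ tb]; split=> //; move: tb h h'.
by rewrite /tgt /src /= !last_cat => + -> ->.
Qed.

Lemma chain_eq_comp a b c a' b' c' :
    pts c = comp_pts a b -> pts c' = comp_pts a' b' ->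
    tgt a = src b -> tgt a' = src b' ->
  chain_eq a a' -> chain_eq b b' -> chain_eq c c'.
Proof.
move=> cE cE' h h' aa bb.
have -> : c = ppath_comp h by apply: val_inj.
have -> : c' = ppath_comp h' by apply: val_inj.
exact: ChainComp.
Qed.

Lemma rev_comp u v : tgt u = src v ->
  rev_pts (comp_pts u v) = comp_pts (rev_pts v) (rev_pts u).
Proof.
case: u v => [p s] [q t]; rewrite /tgt /src /= => <-.
by rewrite /rev_pts /comp_pts /= last_cat belast_cat rev_cat.
Qed.

Lemma chain_eq_rev a b : chain_eq a b -> chain_eq (rev_ppath a) (rev_ppath b).
Proof.
elim=> {a b} [a b ab||||].
- suff : chain_gen (rev_pts a) (rev_pts b) \/ chain_gen (rev_pts b) (rev_pts a).
    by case=> h; [|apply: ChainSym]; apply: ChainGen.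
  case: ab => [p|p q pq|p e f pef].
  + by left; exact: GenId.
  + by left; exact: GenBack.
  by right; apply: GenLinked; rewrite linked_sym.
- by move=> a; exact: ChainRefl.
- by move=> a b _; exact: ChainSym.
- by move=> a b c _ ab _; exact: ChainTrans.
move=> a a' b b' h h' _ aa _ bb.
apply: (chain_eq_comp (a := rev_ppath b) (a' := rev_ppath b')) bb aa => /=.
- exact: rev_comp.
- exact: rev_comp.
- exact: (etrans (tgt_rev b) (esym h)).
- exact: (etrans (tgt_rev b') (esym h')).
Qed.

Lemma tgt_restr_absorb x u : tgt (restr_pts x u) \th_ (tgt u) = tgt (restr_pts x u).
Proof.
case: u => p s; rewrite /tgt /=; elim: s p x => [|q s IHs] p x /=.
  exact: theta_idem.
exact: IHs.
Qed.

Lemma restr_comp x u v : tgt u = src v ->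
  restr_pts x (comp_pts u v) =
  comp_pts (restr_pts x u) (restr_pts (tgt (restr_pts x u)) v).
Proof.
move=> h; have := tgt_restr_absorb x u; rewrite h; case: u v h => [p s] [q t] /=.
rewrite /restr_pts /comp_pts /tgt /src /= => _ E.
rewrite scanl_cat E; congr (_, _ ++ scanl _ _ _).
by elim: s (x \th_ p) {E} => //=.
Qed.

Lemma restr_linked x p e f : linked p e f ->
  linked p (x \th_ e) (x \th_ e \th_ p \th_ f).
Proof.
move=> /andP[_ /eqP eE]; set y := x \th_ e.
have yE : f \th_ p \th_ y = y.
  by rewrite /y -theta_conj -eE theta_swap.
apply/andP; split; apply/eqP.
  by rewrite -theta_conj !theta_swap.
by rewrite theta_conj theta_swap yE.
Qed.

Lemma chain_gen_restr x u v :
  chain_gen u v -> chain_gen (restr_pts x u) (restr_pts x v).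
Proof.
case=> [p|p q pq|p e f pef]; rewrite /restr_pts /=.
- by rewrite theta_idem; exact: GenId.
- have -> : x \th_ p \th_ q \th_ p = x \th_ p.
    by rewrite theta_conj; case/andP: pq => /eqP <-.
  exact/GenBack/restr_step.
have := GenLinked (restr_linked x pef).
rewrite /lambda_pts /rho_pts -!(theta_conj p f) -(theta_conj p e) theta_alt.
by rewrite -{4 5}[x \th_ e]theta_idem !theta_alt theta_idem.
Qed.

Lemma chain_eq_restr x a b : chain_eq a b -> chain_eq (ppath_restr x a) (ppath_restr x b).
Proof.
move=> ab; elim: ab x => {a b} [a b ab|a|a b _ IH|a b c _ IHa _ IHb
  |a a' b b' h h' aa IHa bb IHb] x.
- exact/ChainGen/chain_gen_restr.
- exact: ChainRefl.
- exact: ChainSym.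
- exact: ChainTrans (IHa x) (IHb x).
have [_ te] := chain_eq_ends (IHa x).
have bb' := IHb (tgt (ppath_restr x a)); rewrite {2}te in bb'.
apply: chain_eq_comp (IHa x) bb' => //=.
- exact: restr_comp.
- exact: restr_comp.
- by rewrite -[b.1]/(src b) -h tgt_restr_absorb.
- by rewrite -[b'.1]/(src b') -h' tgt_restr_absorb.
Qed.

Lemma chain_eq_cat a a' b b' c c' :
    pts c = cat_pts a b -> pts c' = cat_pts a' b' ->
  chain_eq a a' -> chain_eq b b' -> chain_eq c c'.
Proof.
move=> cE cE' aa bb.
have [_ te] := chain_eq_ends aa; have [se _] := chain_eq_ends bb.
have cP : path eqF (tgt a) [:: src b].
  by have := ppathP c; rewrite cE cat_path => /andP[_ /=] /andP[-> _].
pose l := @PPath (tgt a, [:: src b]) cP.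
have lb : chain_eq (ppath_comp (erefl : tgt l = src b)) (ppath_comp (se : tgt l = src b')).
  exact: ChainComp (ChainRefl l) bb.
apply: chain_eq_comp aa lb => //=.
by rewrite cE' /cat_pts /comp_pts /= /l /= se.
Qed.

Lemma chain_eq_prod a a' b b' :
  chain_eq a a' -> chain_eq b b' -> chain_eq (ppath_prod a b) (ppath_prod a' b').
Proof.
move=> aa bb.
have [_ te] := chain_eq_ends aa; have [se _] := chain_eq_ends bb.
have ra := chain_eq_rev (chain_eq_restr (src b \th_ (tgt a)) (chain_eq_rev aa)).
have rb := chain_eq_restr (tgt a \th_ (src b)) bb.
by apply: chain_eq_cat ra rb => //=; rewrite /prod_pts te se.
Qed.

Lemma chainE a b : chain a = chain b <-> chain_eq a b.
Proof. by split=> [/eqmodP/asboolP|h] //; apply/eqmodP/asboolP. Qed.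

Lemma chain_eq_repr a : chain_eq (repr (chain a)) a.
Proof. by apply/chainE; exact: reprK. Qed.

Definition PG_mul (u v : PG) : PG := chain (ppath_prod (repr u) (repr v)).
Definition PG_star (u : PG) : PG := chain (rev_ppath (repr u)).

HB.instance Definition _ := hasMul.Build PG PG_mul.
HB.instance Definition _ := hasStar.Build PG PG_star.

Lemma PG_mulE a b : chain a * chain b = chain (ppath_prod a b).
Proof. by apply/chainE; apply: chain_eq_prod; exact: chain_eq_repr. Qed.

Lemma PG_starE a : star (chain a) = chain (rev_ppath a).
Proof. by apply/chainE; apply: chain_eq_rev; exact: chain_eq_repr. Qed.

Definition PG_proj (p : P) : PG := chain (id_path p).

End Paths.

(* Main.v *)
Require Import Defs.
From HB Require Import structures.
From mathcomp Require Import all_boot boolp.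

Set Implicit Arguments.
Unset Strict Implicit.
Unset Printing Implicit Defensive.

(** Write Theta_s = theta_(q_1) ... theta_(q_k) for s = (q_1, ..., q_k).
A path (p_1, ..., p_k) stands for a product of projections p_1 ... p_k, and the
product of two paths a and c first restricts both so that they can be joined:
a is restricted to end at (src c) theta_(tgt a) and c to start at
(tgt a) theta_(src c).

Associativity is the only hard point. In either bracketing of a, b, c, the
pieces coming from a and from c are the same tuples ([restr_outer],
[corestr_outer]): they end at e = (src c) Theta_(b reversed) theta_(tgt a) and
start at f = (tgt a) Theta_b theta_(src c) respectively. In between sits b,
restricted from the left by e in one bracketing and from the right by f in the
other ([corestr_restr], [restr_corestr]). Now f = e Theta_b theta_f and
e = f Theta_(b reversed) theta_e, which for a one-term b says that (e, f) is
linked; the two paths from e to f are then lambda and rho. For a longer b the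
two restrictions are the two sides of a ladder whose rungs can be moved one at
a time, each by a linked pair ([ladder]).

The other axioms of a regular *-semigroup follow from a a* being, as a path, the
palindrome a followed by its reversal, which collapses to src a
([seq_eq_palindrome]). This also gives all projections: if u = [a] is one,
then u = u u* = [src a].

For the universal property, a path is sent to the product of the images of its
entries. The generating pairs become identities in S because
xyxy = xy for projections x, y of S; and restricting a path by x only inserts
x in front of the product ([mulseq_restr]), so products go to products.
Uniqueness holds because [p_1, ..., p_k] is the product of the p_i
([chain_cons]). *)

(** * Sequences of theta operations *)

Section ThetaSequences.
Variable P : projAlgType.
Implicit Types (p q x y e f : P) (s t : seq P).

(** [act x s] is x Theta_s. The last entry of [restr x s] is [act x s], and the
first entry of [corestr x s] is [act x (rev s)]: a path is restricted from its
source by [restr] and from its target by [corestr]. *)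
Definition act x s := foldl (fun y q => y \th_ q) x s.
Definition restr x s := scanl (fun y q => y \th_ q) x s.
Definition corestr x s := rev (restr x (rev s)).

Lemma act_rcons x s q : act x (rcons s q) = act x s \th_ q.
Proof. exact: foldl_rcons. Qed.

Lemma act_rev_cons x q s : act x (rev (q :: s)) = act x (rev s) \th_ q.
Proof. by rewrite rev_cons act_rcons. Qed.

Lemma restr_cat x s t : restr x (s ++ t) = restr x s ++ restr (act x s) t.
Proof. exact: scanl_cat. Qed.

Lemma restr_cons x q s : restr x (q :: s) = x \th_ q :: restr (x \th_ q) s.
Proof. by []. Qed.

Lemma rev_corestr x s : rev (corestr x s) = restr x (rev s).
Proof. exact: revK. Qed.

Lemma rev_restr x s : rev (restr x s) = corestr x (rev s).
Proof. by rewrite /corestr revK. Qed.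

Lemma corestr_cat x s t :
  corestr x (s ++ t) = corestr (act x (rev t)) s ++ corestr x t.
Proof. by rewrite /corestr rev_cat restr_cat rev_cat. Qed.

Lemma corestr_cons x q s :
  corestr x (q :: s) = act x (rev s) \th_ q :: corestr x s.
Proof. by rewrite -cat1s corestr_cat. Qed.

Lemma last_restr x y s : last y (x :: restr x s) = act x s.
Proof. by elim: s x => //= q s IHs x; rewrite -IHs. Qed.

(** This exposes the far end of a linked pair, uniformly for empty and nonempty
[s]. *)
Lemma corestr_headE x s : exists t, rcons (corestr x s) x = act x (rev s) :: t.
Proof.
exists (rev (belast x (restr x (rev s)))).
by rewrite /corestr -rev_cons lastI rev_rcons -(last_restr x x).
Qed.

(** In S this is (b' f b) x (b' f b) = b' (f (b x b') f) b, where b is the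
product of [s] and b' its star. *)
Lemma theta_act f s x :
  x \th_ (act f s) = act (act x (rev s) \th_ f) s.
Proof.
elim: s f x => [|q s IHs] f x //=.
by rewrite IHs act_rev_cons -theta_conj.
Qed.

Lemma theta_theta q p x : x \th_ (p \th_ q) = x \th_ q \th_ p \th_ q.
Proof. by rewrite theta_conj. Qed.

(** In S, the products of [corestr y s] and [s] agree once followed by [y]. *)
Lemma act_corestr x y s :
  act x (corestr y s) \th_ y = act x s \th_ y.
Proof.
suff E t : act x (rev (restr y t)) \th_ y = act x (rev t) \th_ y.
  by rewrite /corestr E revK.
elim: t y => [|q t IHt] y //=.
rewrite !act_rev_cons -[restr _ _]/(restr (y \th_ q) t).
(* The doubled factor makes the induction hypothesis applicable. *)
have -> z : z \th_ (y \th_ q) \th_ y =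
            z \th_ (y \th_ q) \th_ (y \th_ q) \th_ y.
  by rewrite theta_idem.
by rewrite IHt theta_idem theta_theta theta_alt.
Qed.

(** A path restricted from the left by [a] is determined by its first point;
when it is entered from the right by [d], that point moves from [a] to where [d]
arrives under Theta_(s reversed) theta_a. This and the next lemma identify the
middle parts of the two bracketings of a triple product. *)
Lemma corestr_restr d a s :
  corestr d (restr a s) = restr (act d (rev s) \th_ a) s.
Proof.
elim: s a => [|q s IHs] a //.
rewrite act_rev_cons /= -/(restr _ _) corestr_cons IHs -!theta_theta.
congr (_ :: _).
by rewrite rev_restr act_corestr.
Qed.

Lemma restr_corestr a d s :
  restr a (corestr d s) = corestr (act a s \th_ d) s.
Proof.
rewrite -[LHS]revK rev_restr (rev_corestr d) corestr_restr revK.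
by rewrite -rev_corestr revK.
Qed.

(** If x lies below y, then theta_(y theta_q) and theta_q agree on x, and
x theta_q lies below y theta_q, so the argument can be iterated. *)
Lemma restr_restr x y s : x \th_ y = x -> restr x (restr y s) = restr x s.
Proof.
elim: s x y => [|q s IHs] x y //= xy; rewrite -!/(restr _ _).
have E : x \th_ (y \th_ q) = x \th_ q.
  by rewrite theta_theta -{1}xy theta_alt xy.
by rewrite E IHs // -E theta_idem.
Qed.

Lemma act_last x s p : act x (rcons s p) \th_ p = act x (rcons s p).
Proof. by rewrite act_rcons theta_idem. Qed.

(** In a triple product, [rcons s g] is the middle factor, [d :: t] the third one
and [a] the target of the first; the two sides are the third parts of the two
bracketings. Their first points agree because [act_corestr] forgets the
restriction by [d] as soon as theta_d is applied, and they lie below the first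
point of [restr g (d :: t)]. *)
Lemma restr_outer a s g d t :
  restr (act a (corestr d (rcons s g))) (restr g (d :: t)) =
  restr (act a (rcons s g)) (d :: t).
Proof.
rewrite /= -!/(restr _ _).
have -> : act a (corestr d (rcons s g)) \th_ (g \th_ d) =
          act a (rcons s g) \th_ d.
  by rewrite theta_theta act_corestr -act_last theta_alt.
congr (_ :: _); apply: restr_restr.
by rewrite -act_last theta_theta theta_idem theta_alt.
Qed.

(** The mirror image, for the first factor. *)
Lemma corestr_outer a s g d t :
  corestr (act a (rev (restr d (g :: s)))) (corestr g (rcons t d)) =
  corestr (act a (rev (g :: s))) (rcons t d).
Proof.
rewrite /corestr !revK; congr rev.
by rewrite !rev_rcons rev_restr !rev_cons restr_outer.
Qed.

End ThetaSequences.

(** * The path congruence on sequences *)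

Section ChainSequences.
Variable P : projAlgType.
Implicit Types (p q x y e f : P) (s t : seq P) (a b : ppath P).

Definition pts_seq (u : P * seq P) := u.1 :: u.2.

Lemma pts_seq_inj a b : pts_seq a = pts_seq b -> a = b.
Proof.
by case: a b => [[p s] ?] [[q t] ?] [pq st]; apply: val_inj; rewrite /= pq st.
Qed.

Lemma pts_seq_rev u : pts_seq (rev_pts u) = rev (pts_seq u).
Proof. by case: u => p s; rewrite /pts_seq [in RHS]lastI rev_rcons. Qed.

Lemma pts_seq_restr x u : pts_seq (restr_pts x u) = restr x (pts_seq u).
Proof. by []. Qed.

Lemma pts_seq_prod u v :
  pts_seq (prod_pts u v) =
  corestr (src v) (pts_seq u) ++ restr (tgt u) (pts_seq v).
Proof.
rewrite -[LHS]/(pts_seq (rev_pts _) ++ pts_seq (restr_pts _ _)).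
rewrite pts_seq_rev !pts_seq_restr pts_seq_rev; congr (rev _ ++ _).
  by rewrite -pts_seq_rev /pts_seq /= theta_idem.
by rewrite /pts_seq /= theta_idem.
Qed.

Lemma pts_seq_cons u : pts_seq u = src u :: u.2. Proof. by []. Qed.

Lemma pts_seq_rcons u : pts_seq u = rcons (belast u.1 u.2) (tgt u).
Proof. exact: lastI. Qed.

(** The congruence on paths, carried over to nonempty sequences, where
concatenation is associative on the nose and contexts are easy to cut out. *)
Definition seq_eq s t :=
  exists a b, [/\ pts_seq a = s, pts_seq b = t & chain_eq a b].

Lemma seq_eqP a b : seq_eq (pts_seq a) (pts_seq b) <-> chain_eq a b.
Proof.
split=> [[a' [b' [/pts_seq_inj <- /pts_seq_inj <-]]] //|ab].
by exists a, b.
Qed.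

Lemma seq_eq_refl p s : path (@eqF P) p s -> seq_eq (p :: s) (p :: s).
Proof.
move=> ps; exists (@PPath _ (p, s) ps), (@PPath _ (p, s) ps); split=> //.
exact: ChainRefl.
Qed.

Lemma seq_eq_trans s t r : seq_eq s t -> seq_eq t r -> seq_eq s r.
Proof.
case=> a [b [sa <- ab]] [c [d [/pts_seq_inj cb rd cd]]].
by exists a, d; split=> //; apply: ChainTrans ab _; rewrite -cb.
Qed.

Lemma seq_eq_gen (u v : P * seq P) :
  chain_gen u v -> seq_eq (pts_seq u) (pts_seq v).
Proof.
move=> uv; have /andP[hu hv] := chain_gen_path uv.
by exists (PPath hu), (PPath hv); split=> //; apply: ChainGen.
Qed.

Lemma seq_eq_cat s s' t t' :
  sorted (@eqF P) (s ++ t) -> seq_eq s s' -> seq_eq t t' ->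
  seq_eq (s ++ t) (s' ++ t').
Proof.
move=> st [a [a' [sa sa' aa]]] [b [b' [tb tb' bb]]]; subst.
have h : eqF (tgt a) (src b).
  by move: st; rewrite /= cat_path => /andP[_ /andP[]].
have [_ te] := chain_eq_ends aa; have [se _] := chain_eq_ends bb.
have h' : eqF (tgt a') (src b') by rewrite -te -se.
exists (PPath (cat_pathP h)), (PPath (cat_pathP h')); split=> //.
exact: chain_eq_cat aa bb.
Qed.

Lemma seq_eq_catr s s' t :
  sorted (@eqF P) (s ++ t) -> seq_eq s s' -> seq_eq (s ++ t) (s' ++ t).
Proof.
case: t => [|q t]; rewrite ?cats0 // => st ss.
apply: seq_eq_cat => //; apply/seq_eq_refl.
by move: st; rewrite sorted_cat_cons => /andP[].
Qed.

Lemma seq_eq_catl s t t' :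
  sorted (@eqF P) (s ++ t) -> seq_eq t t' -> seq_eq (s ++ t) (s ++ t').
Proof.
case: s => [|q s] // st tt; apply: seq_eq_cat => //; apply/seq_eq_refl.
by move: st; rewrite /= cat_path => /andP[].
Qed.

Lemma seq_eq_sorted s t : seq_eq s t -> sorted (@eqF P) s /\ sorted (@eqF P) t.
Proof. by case=> a [b [<- <- _]]; split; apply: ppathP. Qed.

(** The hypotheses say that (e, f) is linked through the whole of [s]. With
[s = q :: s'], the pair ([e \th_ q], f) is linked through [s'], so the rungs
over [s'] can be moved by induction; afterwards (e, y) is q-linked, where y is
the point following [e \th_ q], and this moves the last rung. *)
Lemma ladder s e f :
    f = act e s \th_ f -> e = act f (rev s) \th_ e ->
  seq_eq (rcons (e :: restr e s) f) (rcons (e :: corestr f s) f).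
Proof.
elim: s e => [|q s IHs] e /=.
  move=> fE eE; apply/seq_eq_refl.
  by rewrite /= andbT /eqF /leF -fE -eE !eqxx.
rewrite act_rev_cons -/(restr _ _).
set e1 := e \th_ q; set y := act f (rev s) => fE eE.
have e1E : e1 = y \th_ e1 by rewrite theta_theta -eE.
have qL : linked q e y.
  apply/andP; split; apply/eqP => //.
  by rewrite /y theta_act revK -fE.
have step1 := IHs e1 fE e1E.
have [srt _] := seq_eq_sorted step1.
have /andP[ee1 _] := linked_eqF qL.
apply: (@seq_eq_trans _ ([:: e] ++ rcons (e1 :: corestr f s) f)).
  by apply: (seq_eq_catl (s := [:: e])) step1; rewrite /= ee1.
have := seq_eq_gen (GenLinked qL); rewrite /lambda_pts /rho_pts /pts_seq /=.
have [t tE] := corestr_headE f s.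
rewrite corestr_cons /= tE -/y => /(seq_eq_catr (t := t)); apply.
move: (seq_eq_sorted step1) => [_]; rewrite /= tE /= => ->.
by rewrite ee1.
Qed.

(** The palindrome collapses from the inside: its middle (p, p) to (p), and then
each (p, q, p) to (p). *)
Lemma seq_eq_palindrome p s :
  path (@eqF P) p s -> seq_eq (p :: s ++ rev (p :: s)) [:: p].
Proof.
elim: s p => [|q s IHs] p /=; first by move=> _; exact: (seq_eq_gen (GenId p)).
case/andP=> pq /IHs IH; have [srt _] := seq_eq_sorted IH.
apply: seq_eq_trans (seq_eq_gen (GenBack pq)).
have -> : [:: p, q & s ++ rev [:: p, q & s]] =
    [:: p] ++ rcons (q :: s ++ rev (q :: s)) p.
  by rewrite (rev_cons p) /= rcons_cat.
have srt' : sorted (@eqF P) (rcons (q :: s ++ rev (q :: s)) p).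
  rewrite /= rcons_path; move: srt => /= -> /=.
  by rewrite last_cat rev_cons last_rcons eqF_sym.
apply: seq_eq_catl; first by rewrite /= pq.
by rewrite -cats1; apply: (seq_eq_catr _ IH); rewrite cats1.
Qed.

Lemma restr_path p s : path (@eqF P) p s -> restr p s = s.
Proof.
elim: s p => [|q s IHs] p //= /andP[/andP[_ /eqP qE] /IHs].
by rewrite -qE => {2}<-.
Qed.

Lemma restr_src a : restr (src a) (pts_seq a) = pts_seq a.
Proof. by rewrite /= theta_self -/(restr _ _) restr_path //; exact: ppathP. Qed.

Lemma corestr_tgt a : corestr (tgt a) (pts_seq a) = pts_seq a.
Proof.
by rewrite -[RHS]revK -pts_seq_rev -(restr_src (rev_ppath a)) pts_seq_rev.
Qed.

End ChainSequences.
Arguments pts_seq : simpl never.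

(** * The chain semigroup *)

Section ChainSemigroup.
Variable P : projAlgType.
Local Open Scope group_scope.
Implicit Types (p q x y e f : P) (s t : seq P) (a b c : ppath P) (u v : PG P).

Lemma chain_surj u : exists a, u = chain a.
Proof. by exists (repr u); rewrite /chain reprK. Qed.

Lemma prod_rev a b :
  rev_ppath (ppath_prod a b) = ppath_prod (rev_ppath b) (rev_ppath a).
Proof.
apply: pts_seq_inj; rewrite pts_seq_rev !pts_seq_prod !pts_seq_rev rev_cat.
by rewrite rev_restr rev_corestr tgt_rev.
Qed.

Lemma tgt_prod a b : tgt (ppath_prod a b) = act (tgt a) (pts_seq b).
Proof.
have E w : tgt w = last (tgt a) (pts_seq w) by [].
by rewrite E pts_seq_prod last_cat -(last_restr (tgt a) (tgt a)).
Qed.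

Lemma src_prod a b : src (ppath_prod a b) = act (src b) (rev (pts_seq a)).
Proof.
rewrite -tgt_rev -[rev_pts _]/(pts (rev_ppath _)) prod_rev tgt_prod.
by rewrite pts_seq_rev tgt_rev.
Qed.

(** Once the outer parts are identified, the two bracketings differ only in
whether the middle path is restricted from the left by [e] or from the right by
[f], and the ladder between [e] and [f] connects them. *)
Lemma chain_eq_prodA a b c :
  chain_eq (ppath_prod a (ppath_prod b c)) (ppath_prod (ppath_prod a b) c).
Proof.
apply: ChainSym; apply/seq_eqP.
have := ppathP (ppath_prod (ppath_prod a b) c).
rewrite -[path _ _ _]/(sorted _ (pts_seq _)).
rewrite !pts_seq_prod corestr_cat restr_cat -!catA tgt_prod src_prod.
set s := pts_seq b; set d := src c; set g := tgt a.
have -> : corestr (act d (rev (restr g s))) (corestr (src b) (pts_seq a)) =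
          corestr (act d (rev s)) (pts_seq a).
  by rewrite /s pts_seq_cons pts_seq_rcons; exact: corestr_outer.
have -> : restr (act g (corestr d s)) (restr (tgt b) (pts_seq c)) =
          restr (act g s) (pts_seq c).
  by rewrite /s pts_seq_rcons; exact: restr_outer.
rewrite corestr_restr restr_corestr.
(* The last point e of the first part and the first point f of the third part
   are the feet of the ladder. *)
rewrite (pts_seq_rcons a) -cats1 corestr_cat -/g.
rewrite (pts_seq_cons c) restr_cons -/d.
rewrite -[corestr _ [:: g]]/[:: act d (rev s) \th_ g].
set e := _ \th_ g; set f := _ \th_ d.
have regroup r t r' :
  (r ++ [:: e]) ++ t ++ f :: r' = r ++ ((e :: t) ++ [:: f]) ++ r'.
  by rewrite -!catA.
rewrite !{}regroup => srt.
have /ladder L : f = act e s \th_ f.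
  by rewrite /e -theta_act /f theta_theta theta_alt theta_swap.
have {L} : seq_eq (rcons (e :: restr e s) f) (rcons (e :: corestr f s) f).
  apply: L; have -> : act f (rev s) = g \th_ (act d (rev s)).
    by rewrite theta_act revK.
  by rewrite theta_theta theta_alt theta_swap.
rewrite -2!cats1 => L.
apply: seq_eq_catl => //; apply: seq_eq_catr => //.
by have [] := cat_sorted2 srt.
Qed.

Lemma PG_mulA : associative (@mul (PG P)).
Proof.
move=> u v w; have [a ->] := chain_surj u; have [b ->] := chain_surj v.
have [c ->] := chain_surj w.
rewrite (PG_mulE b c) (PG_mulE a b) (PG_mulE a) (PG_mulE _ c); apply/chainE.
exact: chain_eq_prodA.
Qed.

Lemma PG_starK : involutive (@star (PG P)).
Proof.
move=> u; have [a ->] := chain_surj u.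
rewrite (PG_starE a) PG_starE; congr chain.
by apply: pts_seq_inj; rewrite !pts_seq_rev revK.
Qed.

Lemma PG_starM u v : star (u * v) = star v * star u.
Proof.
have [a ->] := chain_surj u; have [b ->] := chain_surj v.
by rewrite (PG_mulE a b) (PG_starE a) (PG_starE b) PG_starE PG_mulE prod_rev.
Qed.

(** Composable paths need no restriction, but the product repeats the common
vertex, unlike the composition of the path category. *)
Lemma pts_seq_prod_path a b : tgt a = src b ->
  pts_seq (ppath_prod a b) = pts_seq a ++ pts_seq b.
Proof. by move=> h; rewrite pts_seq_prod -{1}h corestr_tgt h restr_src. Qed.

Lemma PG_mul_star_chain a : chain a * star (chain a) = PG_proj (src a).
Proof.
rewrite PG_starE PG_mulE; apply/chainE/seq_eqP.
rewrite pts_seq_prod_path // pts_seq_rev.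
apply: seq_eq_palindrome; exact: ppathP.
Qed.

Lemma PG_mul_starK u : u * star u * u = u.
Proof.
have [a ->] := chain_surj u; rewrite PG_mul_star_chain PG_mulE.
apply/chainE/seq_eqP; rewrite pts_seq_prod_path //.
have sP := ppathP a.
rewrite pts_seq_cons; apply: (seq_eq_catr _ (seq_eq_gen (GenId (src a)))).
by rewrite /= sP andbT /eqF /leF theta_self eqxx.
Qed.

Theorem PG_regular_star : is_regular_star (PG P).
Proof.
split; [exact: PG_mulA|exact: PG_starK|exact: PG_mul_starK|exact: PG_starM].
Qed.

Lemma PG_proj_is_proj p : is_proj (PG_proj p).
Proof.
apply/andP; split; apply/eqP.
  have <- := PG_mul_star_chain (id_path p).
  by rewrite PG_mulA PG_mul_starK.
by rewrite PG_starE; congr chain; apply: pts_seq_inj.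
Qed.

(** The product of paths is the tuple (q theta_p, p theta_q, q theta_p), an
excursion that collapses to its starting point. *)
Lemma PG_proj_mul p q :
  PG_proj p * PG_proj q * PG_proj p = PG_proj (q \th_ p).
Proof.
rewrite (PG_mulE (id_path p) (id_path q)) PG_mulE; apply/chainE/seq_eqP.
have h := prod_connect p q; rewrite !theta_idem in h.
have -> : pts_seq (ppath_prod (ppath_prod (id_path p) (id_path q)) (id_path p))
    = [:: q \th_ p; p \th_ q; q \th_ p].
  rewrite !pts_seq_prod tgt_prod /pts_seq /corestr /act /rev /src /tgt /=.
  by rewrite !theta_theta !theta_swap.
exact: seq_eq_gen (GenBack h).
Qed.

(** A projection [u] satisfies u = u u = u u*. *)
Lemma is_proj_PG u : is_proj u -> exists p, u = PG_proj p.
Proof.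
have [a ->] := chain_surj u => /andP[/eqP uu /eqP us].
by exists (src a); rewrite -PG_mul_star_chain us uu.
Qed.

(** By iteration, a chain is the product of its entries, so that PG(P) is
generated by P. *)
Lemma chain_cons p a : eqF p (src a) ->
  forall b, pts_seq b = p :: pts_seq a -> chain b = PG_proj p * chain a.
Proof.
move=> /andP[/eqP pq /eqP qp] b bE; rewrite PG_mulE; congr chain.
apply: pts_seq_inj; rewrite pts_seq_prod bE (pts_seq_cons a) restr_cons.
rewrite -qp restr_path; last exact: ppathP.
by rewrite {1}pq.
Qed.

End ChainSemigroup.

(** * Extension of projection algebra morphisms *)

Section Evaluation.
Variables (P : projAlgType) (S : regularStarType) (phi : P -> proj S).
Hypothesis phiM : proj_morphism phi.
Local Open Scope group_scope.
Implicit Types (p q x y e f : P) (s t : seq P) (a b c : ppath P) (w z : S).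
Local Notation v p := (proj_val (phi p)).

Lemma phi_theta p q : v (p \th_ q) = v q * v p * v q.
Proof. by rewrite phiM. Qed.

(** The initial factor [z] gives the empty sequence a product in a semigroup
without identity. *)
Definition mulseq z s := foldl (fun z p => z * v p) z s.
Definition eval (u : P * seq P) : S := mulseq (v u.1) u.2.

Lemma mulseqA w z s : mulseq (w * z) s = w * mulseq z s.
Proof. by elim: s z => //= p s IHs z; rewrite -mulgA IHs. Qed.

(** In S the first entry [x \th_ q] is qxq. It serves as the factor in front of
the remaining entries, and x (qxq) = xq. *)
Lemma mulseq_restr z x s : mulseq (z * v x) (restr x s) = mulseq (z * v x) s.
Proof.
elim: s z x => //= q s IHs z x; rewrite -/(restr _ _).
rewrite IHs; congr (mulseq _ s).
by rewrite phi_theta -!mulgA; congr (z * _); rewrite !mulgA proj_star_mul.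
Qed.

Lemma eval_cat u1 u2 : eval (cat_pts u1 u2) = eval u1 * eval u2.
Proof. by rewrite /eval /= /mulseq foldl_cat /= -!/(mulseq _ _) mulseqA. Qed.

Lemma eval_rev u : eval (rev_pts u) = star (eval u).
Proof.
case: u => p s; elim: s p => [|q s IHs] p; first by rewrite /eval /= proj_starE.
rewrite /eval /= -/(mulseq _ _) mulseqA starM.
rewrite -[mulseq (v q) s]/(eval (q, s)) -IHs.
by rewrite proj_starE rev_cons /mulseq foldl_rcons.
Qed.

Lemma eval_src u : v (src u) * eval u = eval u.
Proof. by rewrite -mulseqA proj_mulE. Qed.

Lemma eval_tgt u : eval u * v (tgt u) = eval u.
Proof.
rewrite -[LHS]starK starM proj_starE -eval_rev (eval_src (rev_pts u)).
by rewrite eval_rev starK.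
Qed.

Lemma eval_comp u1 u2 : tgt u1 = src u2 ->
  eval (comp_pts u1 u2) = eval u1 * eval u2.
Proof.
move=> h; rewrite -[in RHS]mulseqA -/(src u2) -h eval_tgt.
by rewrite /eval /mulseq foldl_cat.
Qed.

Lemma eval_restr x u : eval (restr_pts x u) = v (src u) * v x * eval u.
Proof.
rewrite /eval /= -/(restr _ _) -proj_mulE mulseq_restr proj_mulE phi_theta.
by rewrite mulseqA.
Qed.

(** With p and q the images of the target of [u1] and the source of [u2], the
restrictions put (pqp) p and q (qpq) between the products of [u1] and [u2].
These products already carry a p and a q there, and pqpqpq = pq. *)
Lemma eval_prod u1 u2 : eval (prod_pts u1 u2) = eval u1 * eval u2.
Proof.
have absorb p q : v p * v q * v p * v p * (v q * (v q * v p * v q)) = v p * v q.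
  rewrite !mulgA -(mulgA (v p * v q)) proj_mulE.
  rewrite -(mulgA (v p * v q * v p)) proj_mulE.
  by rewrite !proj_star_mul.
rewrite eval_cat eval_rev !eval_restr eval_rev !starM starK !proj_starE.
rewrite !phi_theta -[in RHS]eval_tgt -[in RHS](eval_src u2).
rewrite !mulgA -[in RHS](mulgA (eval u1)).
by rewrite -[src (rev_pts u1)]/(tgt u1) -(absorb (tgt u1)) !mulgA.
Qed.

Lemma eval_chain_gen u1 u2 : chain_gen u1 u2 -> eval u1 = eval u2.
Proof.
case=> [p|p q /andP[/eqP pq _]|p e f _]; rewrite /eval /=.
- exact: proj_mulE.
- by rewrite -phi_theta -pq.
rewrite !phi_theta !mulgA proj_star_mul -!mulgA.
by congr (_ * _); rewrite !mulgA proj_star_mul.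
Qed.

Lemma eval_chain_eq a b : chain_eq a b -> eval a = eval b.
Proof.
elim=> {a b} [a b /eval_chain_gen //|//|//|a b c _ -> //|].
by move=> a a' b b' h h' _ aa _ bb; rewrite !eval_comp // aa bb.
Qed.

Definition PG_lift (u : PG P) : S := eval (repr u).

Lemma PG_lift_chain a : PG_lift (chain a) = eval a.
Proof. exact/eval_chain_eq/chain_eq_repr. Qed.

Lemma PG_lift_morphism : star_morphism PG_lift.
Proof.
split=> [u1 u2|u].
  have [a ->] := chain_surj u1; have [b ->] := chain_surj u2.
  by rewrite (PG_mulE a b) !PG_lift_chain eval_prod.
have [a ->] := chain_surj u.
by rewrite (PG_starE a) !PG_lift_chain eval_rev.
Qed.

End Evaluation.

(** * Uniqueness of extensions *)

Section Universality.
Variables (P : projAlgType) (S : regularStarType).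
Local Open Scope group_scope.
Implicit Types psi : PG P -> S.

Lemma star_morphism_proj psi p :
  star_morphism psi -> is_proj (psi (PG_proj p)).
Proof.
case=> psiM psiS; have /andP[/eqP pM /eqP pS] := PG_proj_is_proj p.
by rewrite /is_proj /= -psiM -psiS pM pS !eqxx.
Qed.

Lemma star_morphism_ext psi psi' :
  star_morphism psi -> star_morphism psi' ->
  (forall p, psi (PG_proj p) = psi' (PG_proj p)) -> psi = psi'.
Proof.
move=> [psiM _] [psiM' _] E; apply/funext => u; have [a ->] := chain_surj u.
case: a => [[p s] ps]; elim: s p ps => [|q s IHs] p ps.
  have -> : chain (PPath ps) = PG_proj p by congr chain; apply: val_inj.
  exact: E.
have /andP[pq qs] := ps.
rewrite (@chain_cons _ p (@PPath _ (q, s) qs)) //.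
by rewrite psiM psiM' E IHs.
Qed.

End Universality.

Theorem theorem5p8 (P : projAlgType) :
  (exists h : is_regular_star (PG P),
     exists iota : P -> proj (regular_star_of h),
       [/\ forall p : P, proj_val (iota p) = PG_proj p,
           proj_morphism iota
         & bijective iota])
  /\
  (forall S : regularStarType,
     (forall phi : P -> proj S, proj_morphism phi ->
        exists! psi : PG P -> S,
          star_morphism psi /\
          forall p : P, psi (PG_proj p) = proj_val (phi p))
     /\
     (forall psi : PG P -> S, star_morphism psi ->
        exists phi : P -> proj S,
          proj_morphism phi /\
          forall p : P, psi (PG_proj p) = proj_val (phi p))).
Proof.
split=> [|S].
  exists (PG_regular_star P).
  pose iota p : proj (regular_star_of (PG_regular_star P)) :=
    Proj (PG_proj_is_proj p : is_proj (PG_proj p : regular_star_of _)).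
  exists iota; split=> [//|p q|].
    by apply: val_inj; rewrite /= PG_proj_mul.
  exists (fun w => src (repr (proj_val w : PG P))) => [p|[w wP]].
    by have [-> _] := chain_eq_ends (chain_eq_repr (id_path p)).
  apply: val_inj => /=; have [p ->] := is_proj_PG wP.
  by have [-> _] := chain_eq_ends (chain_eq_repr (id_path p)).
split=> [phi phiM|psi psiH].
  exists (PG_lift phi); split=> [|psi [psiH psiE]].
    split; first exact: PG_lift_morphism.
    by move=> p; rewrite PG_lift_chain.
  apply: star_morphism_ext => // [|p]; first exact: PG_lift_morphism.
  by rewrite psiE PG_lift_chain.
exists (fun p => Proj (star_morphism_proj p psiH)); split=> // p q.
by apply: val_inj; have [psiM _] := psiH; rewrite /= -!psiM PG_proj_mul.
Qed.
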